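(* Let $\mathcal E$ be a Banach lattice, let $M:\mathcal E\to\mathcal E$ be a positive compact linear operator, and let $h\in\mathcal E$ be a quasi-interior element of the positive cone $\mathcal E_+$. Then $\|M^nh\|^{1/n}\to r(M)$ as $n\to\infty$, where $r(M)$ is the spectral radius of $M$.
   Context: $M$ is positive if $M(\mathcal E_+)\subset\mathcal E_+$. An element $h\in\mathcal E_+$ is quasi-interior if $\langle h,f\rangle>0$ for every nonzero element $f$ of the positive cone of the dual space $\mathcal E^*$. The spectral radius $r(M)$ is $\sup\{|\lambda|:\lambda\in\sigma(M)\}$. *)

(* Defs.v *)
From Stdlib Require Import Reals Lra.
Open Scope R_scope.

Record BanachLattice := {
  bl_car :> Type;
  bl_zero : bl_car;
  bl_add : bl_car -> bl_car -> bl_car;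
  bl_opp : bl_car -> bl_car;
  bl_scal : R -> bl_car -> bl_car;
  bl_norm : bl_car -> R;
  bl_le : bl_car -> bl_car -> Prop;
  bl_join : bl_car -> bl_car -> bl_car;
  bl_addA : forall x y z, bl_add x (bl_add y z) = bl_add (bl_add x y) z;
  bl_addC : forall x y, bl_add x y = bl_add y x;
  bl_add0 : forall x, bl_add x bl_zero = x;
  bl_addN : forall x, bl_add x (bl_opp x) = bl_zero;
  bl_scalDr : forall a x y, bl_scal a (bl_add x y) = bl_add (bl_scal a x) (bl_scal a y);
  bl_scalDl : forall a b x, bl_scal (a + b) x = bl_add (bl_scal a x) (bl_scal b x);
  bl_scalA : forall a b x, bl_scal a (bl_scal b x) = bl_scal (a * b) x;
  bl_scal1 : forall x, bl_scal 1 x = x;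
  bl_norm_ge0 : forall x, 0 <= bl_norm x;
  bl_norm_eq0 : forall x, bl_norm x = 0 -> x = bl_zero;
  bl_normZ : forall a x, bl_norm (bl_scal a x) = Rabs a * bl_norm x;
  bl_normD : forall x y, bl_norm (bl_add x y) <= bl_norm x + bl_norm y;
  bl_complete : forall u : nat -> bl_car,
    (forall eps, 0 < eps -> exists N, forall m n, (N <= m)%nat -> (N <= n)%nat ->
        bl_norm (bl_add (u m) (bl_opp (u n))) < eps) ->
    exists l, forall eps, 0 < eps -> exists N, forall n, (N <= n)%nat ->
        bl_norm (bl_add (u n) (bl_opp l)) < eps;
  bl_le_refl : forall x, bl_le x x;
  bl_le_anti : forall x y, bl_le x y -> bl_le y x -> x = y;
  bl_le_trans : forall x y z, bl_le x y -> bl_le y z -> bl_le x z;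
  bl_le_add : forall x y z, bl_le x y -> bl_le (bl_add x z) (bl_add y z);
  bl_le_scal : forall a x, 0 <= a -> bl_le bl_zero x -> bl_le bl_zero (bl_scal a x);
  bl_join_l : forall x y, bl_le x (bl_join x y);
  bl_join_r : forall x y, bl_le y (bl_join x y);
  bl_join_least : forall x y z, bl_le x z -> bl_le y z -> bl_le (bl_join x y) z;
  bl_norm_mono : forall x y,
    bl_le (bl_join x (bl_opp x)) (bl_join y (bl_opp y)) -> bl_norm x <= bl_norm y
}.

Section Ops.
Context {E : BanachLattice}.

Definition bsub (x y : E) : E := bl_add E x (bl_opp E y).

Definition positive_elt (x : E) : Prop := bl_le E (bl_zero E) x.

Definition converges (u : nat -> E) (l : E) : Prop :=
  forall eps, 0 < eps -> exists N, forall n, (N <= n)%nat ->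
    bl_norm E (bsub (u n) l) < eps.

Definition linear_op (M : E -> E) : Prop :=
  (forall x y, M (bl_add E x y) = bl_add E (M x) (M y)) /\
  (forall a x, M (bl_scal E a x) = bl_scal E a (M x)).

Definition positive_op (M : E -> E) : Prop :=
  forall x, positive_elt x -> positive_elt (M x).

Definition compact_op (M : E -> E) : Prop :=
  forall u : nat -> E, (exists C, forall n, bl_norm E (u n) <= C) ->
    exists phi : nat -> nat, (forall n, (phi n < phi (S n))%nat) /\
      exists l, converges (fun n => M (u (phi n))) l.

Definition dual_positive (f : E -> R) : Prop :=
  (forall x y, f (bl_add E x y) = f x + f y) /\
  (forall a x, f (bl_scal E a x) = a * f x) /\
  (exists C, forall x, Rabs (f x) <= C * bl_norm E x) /\
  (forall x, positive_elt x -> 0 <= f x).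

Definition quasi_interior (h : E) : Prop :=
  positive_elt h /\
  forall f : E -> R, dual_positive f -> (exists x, f x <> 0) -> 0 < f h.

(** Complexification E_C = E × E, (x,y) ≅ x + i y, with norm ||x|| + ||y||
    (equivalent to any standard complexification norm). *)
Definition cnorm (p : E * E) : R := bl_norm E (fst p) + bl_norm E (snd p).

(** (λ - M_C) for λ = a + i b acting on E_C *)
Definition shifted_op (M : E -> E) (a b : R) (p : E * E) : E * E :=
  let (x, y) := p in
  (bsub (bsub (bl_scal E a x) (bl_scal E b y)) (M x),
   bsub (bl_add E (bl_scal E b x) (bl_scal E a y)) (M y)).

Definition in_resolvent (M : E -> E) (a b : R) : Prop :=
  exists S : E * E -> E * E,
    (forall p, S (shifted_op M a b p) = p) /\
    (forall p, shifted_op M a b (S p) = p) /\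
    (exists C, forall p, cnorm (S p) <= C * cnorm p).

Definition in_spectrum (M : E -> E) (a b : R) : Prop := ~ in_resolvent M a b.

(** r is the spectral radius sup{|λ| : λ ∈ σ(M)} (with sup ∅ = 0; since
    moduli are ≥ 0, adding 0 to the set does not change a nonempty sup). *)
Definition spectral_radius_is (M : E -> E) (r : R) : Prop :=
  is_lub (fun t => t = 0 \/ exists a b, in_spectrum M a b /\ t = sqrt (a * a + b * b)) r.

End Ops.

Definition nth_root (x : R) (n : nat) : R :=
  if Req_EM_T x 0 then 0 else Rpower x (/ INR n).

(* Main.v *)
Require Import Defs.
From Stdlib Require Import Reals Lra Lia List Classical.
From mathcomp Require boolp classical_sets.
Set Bullet Behavior "Strict Subproofs".
Open Scope R_scope.

(** Let [rho] be the exponential growth rate of the powers of [M]. The Neumann series converges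
    for [|lambda| > rho], so [r(M) <= rho], and [limsup ||M^n h||^(1/n) <= rho].

    If [rho > 0], both lower bounds follow from a nonzero positive functional [f] with
    [f (M x) = rho * f x]: it makes [rho - M] non-surjective, and
    [rho^n * f h = f (M^n h) <= ||f|| ||M^n h||], where [f h > 0] as [h] is quasi-interior.
    By Hahn-Banach, such an [f] exists once the wedge [(rho - M) E - E_+] is not dense.
    The resolvents [T] of [M] at [lambda > rho] are positive and blow up as [lambda] decreases to
    [rho]. If [u >= 0] is close to the wedge, then [||T u||] is small compared with [||T||];
    compactness of [M] produces a [u] for which this fails. *)

(* Neither Gelfand's formula nor the spectral theory of compact operators enters. [rho] is the
   infimum of the rates [t] for which [norm (M^n x) <= C t^n norm x] holds with some [C] for all [n]
   and [x]; non-real points of the plane are touched only to show that those of modulus above [rho]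
   are regular. The obstacle is to reach the real point [rho] itself. Positivity places the blow-up
   there: all terms of the series for [T] and for its square are positive operators, so a bound on
   [T] bounds every single power of [M]. A positive eigenvector would not give the lower bound for
   [h]: a quasi-interior [h] need not dominate a multiple of it, and is known only through its
   values under positive functionals. So a functional is sought directly. Separation from a wedge
   asks only for one fixed vector at positive distance, and so avoids adjoints and weak-star limits.
   If [rho = 0] both lower bounds are trivial. *)
Declare Scope vec_scope.
Delimit Scope vec_scope with V.
Bind Scope vec_scope with bl_car.
Arguments bl_join _ (_ _)%_V.
Local Notation "0" := (bl_zero _) : vec_scope.
Local Notation "x + y" := (bl_add _ x y) : vec_scope.
Local Notation "- x" := (bl_opp _ x) : vec_scope.
Local Notation "x - y" := (bsub x y) : vec_scope.
Local Notation "a *: x" := (bl_scal _ a%R x%V) (at level 40, left associativity) : vec_scope.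
Local Notation "x <= y" := (bl_le _ x y) : vec_scope.
Local Notation norm x := (bl_norm _ x%V).
Local Notation abs x := (bl_join _ x (bl_opp _ x)).

(** * Deciding vector identities *)

Section VectorIdentities.
Context {E : BanachLattice}.
Implicit Types x y z : E.

Lemma add0l x : (0 + x = x)%V.
Proof. now rewrite bl_addC, bl_add0. Qed.

Lemma add_cancel_r x y z : (x + z = y + z)%V -> x = y.
Proof.
  intro H. rewrite <- (bl_add0 E x), <- (bl_add0 E y), <- (bl_addN E z), !bl_addA.
  now rewrite H.
Qed.

Lemma scal0l x : (0 *: x = 0)%V.
Proof.
  apply add_cancel_r with (0 *: x)%V. rewrite <- bl_scalDl, add0l. f_equal; ring.
Qed.

Lemma scal0r a : (a *: 0 = 0 :> E)%V.
Proof.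
  apply add_cancel_r with (a *: 0)%V. now rewrite <- bl_scalDr, !add0l.
Qed.

Lemma oppE x : (- x = (-1) *: x)%V.
Proof.
  apply add_cancel_r with x. rewrite (bl_addC _ (- x)%V), bl_addN.
  rewrite <- (bl_scal1 E x) at 2. rewrite <- bl_scalDl, <- (scal0l x).
  f_equal; ring.
Qed.

Lemma add_swap a b c d : ((a + b) + (c + d) = (a + c) + (b + d) :> E)%V.
Proof. rewrite !bl_addA. f_equal. rewrite <- !bl_addA. f_equal. apply bl_addC. Qed.

(** Syntax for proof by reflection: two expressions denote the same vector once their coefficients
    at every atom agree, so a vector identity becomes a list of equations between reals. *)
Inductive vexp :=
| VZero | VVar (i : nat) | VAdd (e f : vexp) | VOpp (e : vexp)
| VSub (e f : vexp) | VScal (a : R) (e : vexp).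

Fixpoint vden (env : list E) (e : vexp) : E :=
  match e with
  | VZero => 0%V
  | VVar i => nth i env 0%V
  | VAdd e f => (vden env e + vden env f)%V
  | VOpp e => (- vden env e)%V
  | VSub e f => (vden env e - vden env f)%V
  | VScal a e => (a *: vden env e)%V
  end.

Fixpoint vcoef (e : vexp) (i : nat) : R :=
  match e with
  | VZero => 0
  | VVar j => if Nat.eqb j i then 1 else 0
  | VAdd e f => vcoef e i + vcoef f i
  | VOpp e => - vcoef e i
  | VSub e f => vcoef e i - vcoef f i
  | VScal a e => a * vcoef e i
  end.

Fixpoint lincomb (c : nat -> R) (env : list E) : E :=
  match env with
  | nil => 0%V
  | x :: env => (c O *: x + lincomb (fun i => c (S i)) env)%V
  end.

Lemma lincomb_add c d env :
  lincomb (fun i => c i + d i) env = (lincomb c env + lincomb d env)%V.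
Proof.
  revert c d; induction env as [|x env IH]; intros c d; simpl.
  - now rewrite bl_add0.
  - now rewrite (IH (fun i => c (S i)) (fun i => d (S i))), bl_scalDl, add_swap.
Qed.

Lemma lincomb_scal a c env :
  lincomb (fun i => a * c i) env = (a *: lincomb c env)%V.
Proof.
  revert c; induction env as [|x env IH]; intros c; simpl.
  - now rewrite scal0r.
  - now rewrite (IH (fun i => c (S i))), bl_scalDr, bl_scalA.
Qed.

(** A recursion rather than a quantifier over indices, so that [cbn] unfolds it to one real equation
    per atom. *)
Fixpoint agree (n : nat) (c d : nat -> R) : Prop :=
  match n with
  | O => True
  | S n => c O = d O /\ agree n (fun i => c (S i)) (fun i => d (S i))
  end.

Lemma lincomb_agree env c d : agree (length env) c d -> lincomb c env = lincomb d env.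
Proof.
  revert c d; induction env as [|x env IH]; intros c d; simpl; [easy|].
  intros [-> H]. now rewrite (IH _ _ H).
Qed.

Lemma agree_all n c d : (forall i, c i = d i) -> agree n c d.
Proof.
  revert c d; induction n as [|n IH]; intros c d H; simpl; [easy|].
  split; [apply H|apply IH; intro; apply H].
Qed.

Lemma lincomb_zero env : lincomb (fun _ => 0) env = 0%V.
Proof.
  induction env as [|x env IH]; simpl; [easy|]. now rewrite IH, scal0l, bl_add0.
Qed.

Lemma lincomb_var env j :
  lincomb (fun i => if Nat.eqb j i then 1 else 0) env = nth j env 0%V.
Proof.
  revert j; induction env as [|x env IH]; intros [|j]; simpl; try easy.
  - now rewrite lincomb_zero, bl_scal1, bl_add0.
  - now rewrite IH, scal0l, add0l.
Qed.

Lemma vden_lincomb env e : vden env e = lincomb (vcoef e) env.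
Proof.
  induction e; cbn [vden vcoef].
  - now rewrite lincomb_zero.
  - now rewrite lincomb_var.
  - now rewrite IHe1, IHe2, <- lincomb_add.
  - rewrite IHe, oppE, <- lincomb_scal. apply lincomb_agree, agree_all.
    intro i. ring.
  - unfold bsub. rewrite IHe1, IHe2, oppE, <- lincomb_scal, <- lincomb_add.
    apply lincomb_agree, agree_all. intro i. ring.
  - now rewrite IHe, <- lincomb_scal.
Qed.

Lemma vden_eq env e f : agree (length env) (vcoef e) (vcoef f) -> vden env e = vden env f.
Proof. intro H. rewrite !vden_lincomb. now apply lincomb_agree. Qed.

End VectorIdentities.

Ltac vec_index x env :=
  lazymatch env with
  | cons x _ => constr:(O)
  | cons _ ?env => let i := vec_index x env in constr:(S i)
  end.

Ltac vec_insert x env :=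
  lazymatch env with
  | context [cons x _] => env
  | _ => constr:(cons x env)
  end.

Ltac vec_env t env :=
  lazymatch t with
  | bl_zero _ => env
  | bl_add _ ?s ?t => let env := vec_env s env in vec_env t env
  | bsub ?s ?t => let env := vec_env s env in vec_env t env
  | bl_opp _ ?s => vec_env s env
  | bl_scal _ _ ?s => vec_env s env
  | _ => vec_insert t env
  end.

Ltac vec_reify t env :=
  lazymatch t with
  | bl_zero _ => constr:(VZero)
  | bl_add _ ?s ?t =>
      let s := vec_reify s env in let t := vec_reify t env in constr:(VAdd s t)
  | bsub ?s ?t =>
      let s := vec_reify s env in let t := vec_reify t env in constr:(VSub s t)
  | bl_opp _ ?s => let s := vec_reify s env in constr:(VOpp s)
  | bl_scal _ ?a ?s => let s := vec_reify s env in constr:(VScal a s)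
  | _ => let i := vec_index t env in constr:(VVar i)
  end.

Ltac vec_step :=
  lazymatch goal with
  | |- @eq ?T ?s ?t =>
      let env := vec_env s (@nil T) in
      let env := vec_env t env in
      let e := vec_reify s env in
      let f := vec_reify t env in
      change (vden env e = vden env f); apply vden_eq;
      cbn [length agree vcoef Nat.eqb]
  end.

Ltac vec := vec_step; repeat split; try ring; try lra.

(** * Order and norm *)

Section OrderNorm.
Context {E : BanachLattice}.
Implicit Types x y z u v : E.

Lemma le_sub x y : (x <= y)%V -> (0 <= y - x)%V.
Proof.
  intro H. apply (bl_le_add E _ _ (- x)%V) in H. now rewrite bl_addN in H.
Qed.

Lemma sub_le x y : (0 <= y - x)%V -> (x <= y)%V.
Proof.
  intro H. apply (bl_le_add E _ _ x) in H.
  replace (0 + x)%V with x in H by vec.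
  now replace (y - x + x)%V with y in H by vec.
Qed.

Lemma add_ge0 x y : (0 <= x)%V -> (0 <= y)%V -> (0 <= x + y)%V.
Proof.
  intros Hx Hy. apply bl_le_trans with y; [easy|].
  apply sub_le. now replace (x + y - y)%V with x by vec.
Qed.

(** An order certificate: the inequality is exhibited as a nonnegative multiple of a known one, and
    the identity that remains is within reach of [vec]. *)
Lemma le_of_comb1 a x y u v : 0 <= a -> (u <= v)%V ->
  (y - x = a *: (v - u))%V -> (x <= y)%V.
Proof.
  intros Ha H e. apply sub_le. rewrite e. apply bl_le_scal; [easy|]. now apply le_sub.
Qed.

Lemma le_of_comb2 a b x y u v u' v' : 0 <= a -> 0 <= b -> (u <= v)%V -> (u' <= v')%V ->
  (y - x = a *: (v - u) + b *: (v' - u'))%V -> (x <= y)%V.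
Proof.
  intros Ha Hb H H' e. apply sub_le. rewrite e.
  apply add_ge0; apply bl_le_scal; trivial; now apply le_sub.
Qed.

Lemma abs_ge0 x : (0 <= abs x)%V.
Proof.
  apply (le_of_comb2 (1/2) (1/2) _ _ _ _ _ _ ltac:(lra) ltac:(lra)
           (bl_join_l E x (- x)%V) (bl_join_r E x (- x)%V)).
  vec.
Qed.

Lemma opp_le_self x : (0 <= x)%V -> (- x <= x)%V.
Proof. intro H. apply (le_of_comb1 2 _ _ _ _ ltac:(lra) H). vec. Qed.

Lemma abs_pos x : (0 <= x)%V -> abs x = x.
Proof.
  intro H. apply bl_le_anti; [|apply bl_join_l].
  apply bl_join_least; [apply bl_le_refl|now apply opp_le_self].
Qed.

Lemma norm_abs x : norm (abs x) = norm x.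
Proof.
  apply Rle_antisym; apply bl_norm_mono; rewrite (abs_pos _ (abs_ge0 x)); apply bl_le_refl.
Qed.

Lemma norm_le_of_abs x y : (x <= y)%V -> (- x <= y)%V -> norm x <= norm y.
Proof.
  intros H1 H2. apply bl_norm_mono. apply bl_le_trans with y; [|apply bl_join_l].
  now apply bl_join_least.
Qed.

Lemma norm_le_pos x y : (0 <= x)%V -> (x <= y)%V -> norm x <= norm y.
Proof.
  intros H0 H. apply norm_le_of_abs; [easy|].
  apply bl_le_trans with x; [now apply opp_le_self|easy].
Qed.

Lemma norm0 : norm (0 : E) = 0.
Proof. rewrite <- (scal0l 0%V), bl_normZ, Rabs_R0. ring. Qed.

Lemma normN x : norm (- x) = norm x.
Proof. rewrite oppE, bl_normZ, Rabs_left; lra. Qed.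

Lemma norm_sub_le x y : norm (x - y) <= norm x + norm y.
Proof. unfold bsub. rewrite <- (normN y). apply bl_normD. Qed.

Lemma norm_sub_ge x y : norm x - norm y <= norm (x - y).
Proof.
  pose proof (bl_normD E (x - y)%V y) as H.
  replace (x - y + y)%V with x in H by vec. lra.
Qed.

Lemma norm_subC x y : norm (x - y) = norm (y - x).
Proof. rewrite <- normN. f_equal. vec. Qed.

Lemma small_norm_eq0 x : (forall eps, 0 < eps -> norm x < eps) -> x = 0%V.
Proof.
  intro H. apply bl_norm_eq0. pose proof (bl_norm_ge0 E x).
  destruct (Req_dec (norm x) 0) as [|n]; [easy|].
  specialize (H (norm x) ltac:(lra)). lra.
Qed.

(** * Limits of sequences *)

Lemma converges_unique (u : nat -> E) l m : converges u l -> converges u m -> l = m.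
Proof.
  intros Hl Hm. enough (l - m = 0)%V as e.
  { replace l with (l - m + m)%V by vec. rewrite e. vec. }
  apply small_norm_eq0. intros eps He.
  destruct (Hl (eps/2) ltac:(lra)) as [N HN]. destruct (Hm (eps/2) ltac:(lra)) as [N' HN'].
  specialize (HN (max N N') ltac:(lia)). specialize (HN' (max N N') ltac:(lia)).
  replace (l - m)%V with ((u (max N N') - m) - (u (max N N') - l))%V by vec.
  pose proof (norm_sub_le (u (max N N') - m)%V (u (max N N') - l)%V). lra.
Qed.

Lemma converges_ext (u v : nat -> E) l :
  (forall n, u n = v n) -> converges u l -> converges v l.
Proof.
  intros e H eps He. destruct (H eps He) as [N HN]. exists N. intros n Hn.
  rewrite <- e. now apply HN.
Qed.

Lemma converges_add (u v : nat -> E) l m :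
  converges u l -> converges v m -> converges (fun n => u n + v n)%V (l + m)%V.
Proof.
  intros Hl Hm eps He.
  destruct (Hl (eps/2) ltac:(lra)) as [N HN]. destruct (Hm (eps/2) ltac:(lra)) as [N' HN'].
  exists (max N N'). intros n Hn.
  specialize (HN n ltac:(lia)). specialize (HN' n ltac:(lia)).
  replace (u n + v n - (l + m))%V with ((u n - l) + (v n - m))%V by vec.
  pose proof (bl_normD E (u n - l)%V (v n - m)%V). lra.
Qed.

Lemma converges_lipschitz (F : E -> E) (K : R) (u : nat -> E) l :
  (forall x y, norm (F x - F y) <= K * norm (x - y)) ->
  converges u l -> converges (fun n => F (u n)) (F l).
Proof.
  intros HF H eps He. pose proof (Rabs_pos K). pose proof (Rle_abs K).
  destruct (H (eps / (Rabs K + 1))) as [N HN]; [apply Rdiv_lt_0_compat; lra|].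
  exists N. intros n Hn. specialize (HN n Hn). specialize (HF (u n) l).
  apply (Rmult_lt_compat_l (Rabs K + 1)) in HN; [|lra].
  replace ((Rabs K + 1) * (eps / (Rabs K + 1))) with eps in HN by (field; lra).
  pose proof (bl_norm_ge0 E (u n - l)%V). nra.
Qed.

Lemma converges_scal a (u : nat -> E) l :
  converges u l -> converges (fun n => a *: u n)%V (a *: l)%V.
Proof.
  apply (converges_lipschitz (fun x => a *: x)%V (Rabs a)). intros x y.
  rewrite <- bl_normZ. apply Req_le. f_equal. vec.
Qed.

Lemma converges_const (x : E) : converges (fun _ => x) x.
Proof.
  intros eps He. exists O. intros n _. replace (x - x)%V with (0 : E)%V by vec.
  now rewrite norm0.
Qed.

Lemma converges_shift (u : nat -> E) l : converges (fun n => u (S n)) l -> converges u l.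
Proof.
  intros H eps He. destruct (H eps He) as [N HN]. exists (S N). intros [|n] Hn; [lia|].
  apply HN. lia.
Qed.

(* The negative part of the limit is dominated by the distance to any term. *)
Lemma converges_ge0 (u : nat -> E) l :
  converges u l -> (forall n, (0 <= u n)%V) -> (0 <= l)%V.
Proof.
  intros H Hu. assert (e : bl_join E (- l) 0 = 0%V).
  { apply small_norm_eq0. intros eps He. destruct (H eps He) as [N HN].
    apply Rle_lt_trans with (2 := HN N (le_n N)).
    rewrite <- (norm_abs (u N - l)). apply norm_le_pos; [apply bl_join_r|].
    apply bl_join_least; [|apply abs_ge0].
    apply bl_le_trans with (u N - l)%V; [|apply bl_join_l].
    apply sub_le. now replace (u N - l - - l)%V with (u N) by vec. }
  apply (le_of_comb1 1 _ _ (- l)%V (bl_join E (- l) 0) ltac:(lra) (bl_join_l _ _ _)).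
  rewrite e. vec.
Qed.

Lemma converges_norm_le (u : nat -> E) l K :
  converges u l -> (forall n, norm (u n) <= K) -> norm l <= K.
Proof.
  intros H Hu. apply le_epsilon. intros eps He. destruct (H eps He) as [N HN].
  specialize (HN N (le_n N)). specialize (Hu N). rewrite norm_subC in HN.
  pose proof (norm_sub_ge l (u N)). lra.
Qed.

(** The factor [1 - q ^ k] makes the induction on [k] an exact geometric summation; the bound
    without it does not reproduce itself. *)
Lemma geometric_tail (u : nat -> E) K q : 0 <= q < 1 ->
  (forall n, norm (u (S n) - u n) <= K * q ^ n) ->
  forall n k, norm (u (n + k)%nat - u n) <= K / (1 - q) * q ^ n * (1 - q ^ k).
Proof.
  intros Hq H n k. induction k as [|k IH].
  - rewrite Nat.add_0_r. replace (u n - u n)%V with (0 : E)%V by vec.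
    rewrite norm0. simpl. lra.
  - rewrite Nat.add_succ_r. specialize (H (n + k)%nat).
    replace (u (S (n + k)) - u n)%V
      with ((u (S (n + k)) - u (n + k)%nat) + (u (n + k)%nat - u n))%V by vec.
    apply Rle_trans with (1 := bl_normD _ _ _).
    rewrite pow_add in H.
    replace (K / (1 - q) * q ^ n * (1 - q ^ S k))
      with (K * (q ^ n * q ^ k) + K / (1 - q) * q ^ n * (1 - q ^ k))
      by (simpl; field; lra).
    lra.
Qed.

Lemma geometric_converges (u : nat -> E) K q : 0 <= K -> 0 <= q < 1 ->
  (forall n, norm (u (S n) - u n) <= K * q ^ n) -> exists l, converges u l.
Proof.
  intros HK Hq H. pose proof (geometric_tail u K q Hq H) as T.
  set (B := K / (1 - q)) in T.
  assert (HB : 0 <= B) by (apply Rmult_le_pos; [lra|]; left; apply Rinv_0_lt_compat; lra).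
  assert (T' : forall n k, norm (u (n + k)%nat - u n) <= B * q ^ n).
  { intros n k. apply Rle_trans with (1 := T n k).
    pose proof (pow_le q n (proj1 Hq)). pose proof (pow_le q k (proj1 Hq)).
    assert (0 <= B * q ^ n) by now apply Rmult_le_pos. nra. }
  apply (bl_complete E u). intros eps He.
  destruct (pow_lt_1_zero q ltac:(rewrite Rabs_pos_eq; lra) (eps / (2 * (B + 1))))
    as [N HN]; [apply Rdiv_lt_0_compat; lra|].
  specialize (HN N (le_n N)). rewrite Rabs_pos_eq in HN by now apply pow_le.
  assert (HN' : B * q ^ N < eps / 2).
  { apply (Rmult_lt_compat_l (B + 1)) in HN; [|lra].
    replace ((B + 1) * (eps / (2 * (B + 1)))) with (eps / 2) in HN by (field; lra).
    pose proof (pow_le q N (proj1 Hq)). lra. }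
  exists N. intros m n Hm Hn. change (norm (u m - u n) < eps).
  pose proof (T' N (m - N)%nat) as T1. pose proof (T' N (n - N)%nat) as T2.
  replace (N + (m - N))%nat with m in T1 by lia.
  replace (N + (n - N))%nat with n in T2 by lia.
  replace (u m - u n)%V with ((u m - u N) - (u n - u N))%V by vec.
  pose proof (norm_sub_le (u m - u N)%V (u n - u N)%V). lra.
Qed.

End OrderNorm.

(** * The Hahn-Banach theorem *)

Section Infimum.

Definition is_inf (P : R -> Prop) (m : R) : Prop :=
  (forall r, P r -> m <= r) /\ (forall b, (forall r, P r -> b <= r) -> b <= m).

Lemma inf_exists (P : R -> Prop) b :
  (exists r, P r) -> (forall r, P r -> b <= r) -> exists m, is_inf P m.
Proof.
  intros [r0 Hr0] Hb.
  destruct (completeness (fun s => P (- s))) as [m [Hm1 Hm2]].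
  - exists (- b). intros s Hs. specialize (Hb _ Hs). lra.
  - exists (- r0). now rewrite Ropp_involutive.
  - exists (- m). split.
    + intros r Hr. specialize (Hm1 (- r)). cbn in Hm1.
      rewrite Ropp_involutive in Hm1. specialize (Hm1 Hr). lra.
    + intros c Hc. specialize (Hm2 (- c)).
      enough (m <= - c) by lra. apply Hm2. intros s Hs. specialize (Hc _ Hs). lra.
Qed.

Lemma inf_add P Q p q z : is_inf P p -> is_inf Q q ->
  (forall r s, P r -> Q s -> z <= r + s) -> z <= p + q.
Proof.
  intros [_ HP] [_ HQ] H. enough (z - q <= p) by lra. apply HP. intros r Hr.
  enough (z - r <= q) by lra. apply HQ. intros s Hs. specialize (H r s Hr Hs). lra.
Qed.

Lemma inf_scal P p a z : is_inf P p -> (exists r, P r) -> 0 <= a ->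
  (forall r, P r -> z <= a * r) -> z <= a * p.
Proof.
  intros [_ HP] [r0 Hr0] Ha H. destruct (Req_dec a 0) as [->|n].
  - specialize (H r0 Hr0). lra.
  - assert (Ha' : 0 < a) by lra. enough (z / a <= p) as Hz.
    { apply (Rmult_le_compat_l a) in Hz; [|easy].
      now replace (a * (z / a)) with z in Hz by (field; lra). }
    apply HP. intros r Hr. specialize (H r Hr).
    apply Rmult_le_reg_l with a; [easy|].
    now replace (a * (z / a)) with z by (field; lra).
Qed.

End Infimum.

Section HahnBanach.
Context {E : BanachLattice}.
Implicit Types x y a : E.

(** Only one inequality is asked for scalars, since that is what infima deliver; equality follows by
    applying it to [/ t] as well. *)
Definition sublinear (p : E -> R) : Prop :=
  (forall x y, p (x + y)%V <= p x + p y) /\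
  (forall t x, 0 <= t -> p (t *: x)%V <= t * p x).

Lemma sublinear_scal p t x : sublinear p -> 0 <= t -> p (t *: x)%V = t * p x.
Proof.
  intros [Hadd Hscal] Ht. apply Rle_antisym; [now apply Hscal|].
  destruct (Req_dec t 0) as [->|n].
  - rewrite scal0l. pose proof (Hadd 0%V 0%V) as H0. rewrite bl_add0 in H0. lra.
  - specialize (Hscal (/ t) (t *: x)%V ltac:(left; apply Rinv_0_lt_compat; lra)).
    rewrite bl_scalA, Rinv_l, bl_scal1 in Hscal by lra.
    apply (Rmult_le_compat_l t) in Hscal; [|lra].
    now replace (t * (/ t * p (t *: x)%V)) with (p (t *: x)%V) in Hscal by (field; lra).
Qed.

Lemma sublinear_zero p : sublinear p -> p 0%V = 0.
Proof.
  intro Hp. rewrite <- (scal0l 0%V), (sublinear_scal p); trivial; lra.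
Qed.

Lemma sublinear_ge_opp p x : sublinear p -> - p (- x)%V <= p x.
Proof.
  intro Hp. pose proof (proj1 Hp x (- x)%V) as H. rewrite bl_addN in H.
  rewrite (sublinear_zero p Hp) in H. lra.
Qed.

Lemma inf_fun (P : E -> R -> Prop) (b : E -> R) :
  (forall x, exists r, P x r) -> (forall x r, P x r -> b x <= r) ->
  exists p, forall x, is_inf (P x) (p x).
Proof.
  intros Hne Hb. destruct (@boolp.choice E R (fun x => is_inf (P x))) as [p Hp].
  - intro x. apply inf_exists with (b x); [apply Hne|apply Hb].
  - now exists p.
Qed.

(* The largest sublinear functional below [p] whose value at [- a] is at most
   [- p a]; sublinear functionals stable under this operation are linear. *)
Lemma sublinear_slide p a : sublinear p ->
  exists q, sublinear q /\ (forall x, q x <= p x) /\ (forall x, q x <= p (x + a)%V - p a).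
Proof.
  intro Hp. pose proof Hp as [Hadd Hscal].
  set (P := fun x r => exists t, 0 <= t /\ r = p (x + t *: a)%V - t * p a).
  assert (Hne : forall x, exists r, P x r).
  { intro x. exists (p (x + 0 *: a)%V - 0 * p a). exists 0. split; [lra|easy]. }
  destruct (inf_fun P (fun x => - p (- x)%V)) as [q Hq]; [easy| |].
  { intros x r [t [Ht ->]]. rewrite <- sublinear_scal by easy.
    pose proof (Hadd (x + t *: a)%V (- x)%V) as H.
    replace (x + t *: a + - x)%V with (t *: a)%V in H by vec. lra. }
  exists q. repeat split.
  - intros x y. apply (inf_add _ _ _ _ _ (Hq x) (Hq y)).
    intros r s [t [Ht ->]] [t' [Ht' ->]].
    apply Rle_trans with (p ((x + y) + (t + t') *: a)%V - (t + t') * p a).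
    + apply (Hq (x + y)%V). exists (t + t'). split; [lra|easy].
    + pose proof (Hadd (x + t *: a)%V (y + t' *: a)%V) as H.
      replace (x + t *: a + (y + t' *: a))%V with ((x + y) + (t + t') *: a)%V in H by vec.
      lra.
  - intros s x Hs. apply (inf_scal _ _ _ _ (Hq x)); [apply Hne|easy|].
    intros r [t [Ht ->]].
    apply Rle_trans with (p (s *: x + (s * t) *: a)%V - (s * t) * p a).
    + apply (Hq (s *: x)%V). exists (s * t). split; [now apply Rmult_le_pos|easy].
    + pose proof (Hscal s (x + t *: a)%V Hs) as H.
      replace (s *: (x + t *: a))%V with (s *: x + (s * t) *: a)%V in H by vec. lra.
  - intro x. apply (Hq x). exists 0. split; [lra|].
    replace (x + 0 *: a)%V with x by vec. ring.
  - intro x. apply (Hq x). exists 1. split; [lra|].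
    replace (x + 1 *: a)%V with (x + a)%V by vec. ring.
Qed.

(** Zorn's lemma for the reversed pointwise order: the pointwise infimum of a nonempty chain is
    finite, being at least [- p (- x)], and is again sublinear. The preorder version dispenses with
    antisymmetry, which would require equality of functions. *)
Lemma sublinear_minimal p : sublinear p ->
  exists q, sublinear q /\ (forall x, q x <= p x) /\
    forall q', sublinear q' -> (forall x, q' x <= q x) -> forall x, q x <= q' x.
Proof.
  intro Hp.
  set (T := {q : E -> R | sublinear q /\ forall x, q x <= p x}).
  set (below := fun s t : T => boolp.asbool (forall x, proj1_sig t x <= proj1_sig s x)).
  assert (belowE : forall s t, is_true (below s t) <->
                    (forall x, proj1_sig t x <= proj1_sig s x)).
  { intros s t. unfold below. split; intro H.
    - exact (boolp.asboolW H).
    - exact (boolp.asboolT H). }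
  set (t0 := exist _ p (conj Hp (fun x => Rle_refl (p x))) : T).
  destruct (@classical_sets.ZL_preorder T t0 below) as [t Ht].
  - intro t. apply belowE. intro x. lra.
  - intros r s t H1 H2. apply belowE. intro x.
    apply Rle_trans with (proj1_sig s x); now apply belowE.
  - intros A HA. destruct (classic (exists t, A t)) as [[t1 Ht1]|none].
    2: { exists t0. intros s Hs. now destruct none; exists s. }
    set (P := fun x r => exists t, A t /\ r = proj1_sig t x).
    assert (Hne : forall x, exists r, P x r) by (intro x; exists (proj1_sig t1 x), t1; easy).
    destruct (inf_fun P (fun x => - p (- x)%V)) as [q Hq]; [easy| |].
    { intros x r [t [_ ->]]. destruct t as [f [Hf Hfp]]. simpl.
      pose proof (sublinear_ge_opp f x Hf). specialize (Hfp (- x)%V). lra. }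
    assert (Hqs : sublinear q).
    { split.
      - intros x y. apply (inf_add _ _ _ _ _ (Hq x) (Hq y)).
        intros r s [f [Hf ->]] [g [Hg ->]].
        (* Of two members of the chain the lower one lies below both, so its subadditivity bounds
           the mixed sum. *)
        assert (exists k, A k /\ (forall z, proj1_sig k z <= proj1_sig f z) /\
                          (forall z, proj1_sig k z <= proj1_sig g z)) as [k [Hk [Hkf Hkg]]].
        { destruct (HA f g Hf Hg) as [H|H]; rewrite belowE in H.
          - exists g. repeat split; trivial. intro; lra.
          - exists f. repeat split; trivial. intro; lra. }
        apply Rle_trans with (proj1_sig k (x + y)%V).
        + apply (Hq (x + y)%V). now exists k.
        + destruct (proj2_sig k) as [[Hadd _] _]. specialize (Hadd x y).
          specialize (Hkf x). specialize (Hkg y). lra.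
      - intros s x Hs. apply (inf_scal _ _ _ _ (Hq x)); [apply Hne|easy|].
        intros r [f [Hf ->]]. apply Rle_trans with (proj1_sig f (s *: x)%V).
        + apply (Hq (s *: x)%V). now exists f.
        + now apply (proj2_sig f). }
    assert (Hqp : forall x, q x <= p x).
    { intro x. apply Rle_trans with (proj1_sig t1 x).
      - apply (Hq x). now exists t1.
      - apply (proj2_sig t1). }
    exists (exist _ q (conj Hqs Hqp)). intros s Hs. apply belowE. intro x.
    apply (Hq x). now exists s.
  - exists (proj1_sig t). destruct (proj2_sig t) as [Hs Hle]. repeat split; try apply Hs; trivial.
    intros q' Hq' Hqt.
    assert (Hqp : forall x, q' x <= p x).
    { intro x. specialize (Hqt x). specialize (Hle x). lra. }
    specialize (Ht (exist _ q' (conj Hq' Hqp))). rewrite !belowE in Ht. now apply Ht.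
Qed.

(** No extension from subspaces is involved. Sliding [p] along [u] first forces [f (- u) <= - p u]
    for everything below the result. A minimal sublinear [f] cannot be lowered by sliding along [y],
    so [f x <= f (x + y) - f y], the missing half of additivity. *)
Theorem hahn_banach p u : sublinear p ->
  exists f : E -> R, (forall x y, f (x + y)%V = f x + f y) /\
    (forall t x, f (t *: x)%V = t * f x) /\
    (forall x, f x <= p x) /\ p u <= f u.
Proof.
  intro Hp. destruct (sublinear_slide p u Hp) as [pu [Hpu [Hpup Hpuu]]].
  destruct (sublinear_minimal pu Hpu) as [f [Hf [Hfpu Hmin]]].
  assert (Hadd : forall x y, f (x + y)%V = f x + f y).
  { intros x y. apply Rle_antisym; [apply Hf|].
    destruct (sublinear_slide f y Hf) as [q [Hq [Hqf Hqy]]].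
    specialize (Hmin q Hq Hqf x). specialize (Hqy x). lra. }
  assert (Hopp : forall x, f (- x)%V = - f x).
  { intro x. specialize (Hadd x (- x)%V). rewrite bl_addN, (sublinear_zero f Hf) in Hadd.
    lra. }
  exists f. repeat split; trivial.
  - intros t x. destruct (Rle_dec 0 t).
    + now apply sublinear_scal.
    + replace (t *: x)%V with (- ((- t) *: x))%V by vec.
      rewrite Hopp, sublinear_scal by (trivial; lra). ring.
  - intro x. apply Rle_trans with (pu x); trivial.
  - specialize (Hpuu (- u)%V). specialize (Hfpu (- u)%V).
    replace (- u + u)%V with (0 : E)%V in Hpuu by vec.
    rewrite (sublinear_zero p Hp) in Hpuu. rewrite Hopp in Hfpu. lra.
Qed.

End HahnBanach.

(** * Power series in an operator *)

Section Operators.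
Context {E : BanachLattice}.
Implicit Types x y z u l : E.

Lemma linear_sub (F : E -> E) x y : linear_op F -> F (x - y)%V = (F x - F y)%V.
Proof.
  intros [Hadd Hscal]. replace (x - y)%V with (x + (-1) *: y)%V by vec.
  rewrite Hadd, Hscal. vec.
Qed.

Lemma linear_zero (F : E -> E) : linear_op F -> F 0%V = 0%V.
Proof. intros [_ Hscal]. rewrite <- (scal0l 0%V), Hscal. vec. Qed.

Lemma linear_opp (F : E -> E) x : linear_op F -> F (- x)%V = (- F x)%V.
Proof.
  intros [_ Hscal]. replace (- x)%V with ((-1) *: x)%V by vec. rewrite Hscal. vec.
Qed.

Lemma positive_le (F : E -> E) x y :
  linear_op F -> positive_op F -> (x <= y)%V -> (F x <= F y)%V.
Proof.
  intros Hl Hp H. apply sub_le. rewrite <- linear_sub by easy. apply Hp. now apply le_sub.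
Qed.

(** Both [F x] and [- F x] lie below [F (abs x)]; norm bounds for positive operators thereby reduce
    to positive vectors. *)
Lemma positive_norm_abs (F : E -> E) x :
  linear_op F -> positive_op F -> norm (F x) <= norm (F (abs x)).
Proof.
  intros Hl Hp. apply norm_le_of_abs; [|rewrite <- linear_opp by easy];
    apply positive_le; trivial; [apply bl_join_l|apply bl_join_r].
Qed.

Lemma iter_linear (M : E -> E) n : linear_op M -> linear_op (Nat.iter n M).
Proof.
  intros [Hadd Hscal]. split; intros; induction n as [|n IH]; simpl; trivial.
  - now rewrite IH, Hadd.
  - now rewrite IH, Hscal.
Qed.

Lemma iter_positive (M : E -> E) n : positive_op M -> positive_op (Nat.iter n M).
Proof. intros HM x Hx. induction n as [|n IH]; simpl; [easy|]. now apply HM. Qed.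

Definition bounded_by (F : E -> E) (C : R) : Prop := forall x, norm (F x) <= C * norm x.

(* A sequence violating every bound would have an image without convergent subsequence. *)
Lemma compact_bounded (M : E -> E) :
  linear_op M -> compact_op M -> exists C, 0 < C /\ bounded_by M C.
Proof.
  intros HM Hc. apply NNPP. intro Hno.
  assert (Hv : forall n, exists v, norm v <= 1 /\ INR n <= norm (M v)).
  { intro n. apply NNPP. intro Hn. apply Hno. exists (INR n + 1).
    pose proof (pos_INR n). split; [lra|]. intro x.
    destruct (Req_dec (norm x) 0) as [e|ne].
    - rewrite (bl_norm_eq0 E x e), linear_zero, !norm0 by easy. lra.
    - pose proof (bl_norm_ge0 E x). apply Rnot_lt_le. intro Hlt. apply Hn.
      exists (/ norm x *: x)%V. rewrite (proj2 HM), !bl_normZ, Rabs_pos_eq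
        by (left; apply Rinv_0_lt_compat; lra).
      rewrite Rinv_l by easy. split; [lra|].
      apply Rmult_le_reg_l with (norm x); [lra|].
      replace (norm x * (/ norm x * norm (M x))) with (norm (M x)) by (field; easy).
      nra. }
  destruct (boolp.choice Hv) as [v Hv'].
  destruct (Hc v) as [phi [Hphi [l Hl]]].
  { exists 1. intro n. apply Hv'. }
  destruct (Hl 1 ltac:(lra)) as [N HN].
  assert (Hge : forall n, (n <= phi n)%nat).
  { induction n as [|n IH]; [lia|]. specialize (Hphi n). lia. }
  destruct (INR_unbounded (norm l + 1)) as [k Hk].
  specialize (HN (max N k) ltac:(lia)). simpl in HN.
  pose proof (proj2 (Hv' (phi (max N k)))) as H1.
  pose proof (Hge (max N k)).
  assert (INR k <= INR (phi (max N k))) by (apply le_INR; lia).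
  pose proof (norm_sub_ge (M (v (phi (max N k)))) l). lra.
Qed.

(** The infimum of these [t] is the growth rate. The constant [C] and the pointwise form replace
    operator norms and limits of their roots. *)
Definition pow_bound (M : E -> E) (t : R) : Prop :=
  0 < t /\ exists C, 0 <= C /\ forall n x, norm (Nat.iter n M x) <= C * t ^ n * norm x.

Lemma iter_norm (F : E -> E) a n x : 0 <= a -> bounded_by F a ->
  norm (Nat.iter n F x) <= a ^ n * norm x.
Proof.
  intros Ha HF. induction n as [|n IH]; simpl; [lra|].
  apply Rle_trans with (1 := HF _). rewrite Rmult_assoc. now apply Rmult_le_compat_l.
Qed.

Lemma bounded_pow_bound (M : E -> E) C : 0 < C -> bounded_by M C -> pow_bound M C.
Proof.
  intros HC HM. split; [easy|]. exists 1. split; [lra|]. intros n x.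
  rewrite Rmult_1_l. apply iter_norm; [lra|easy].
Qed.

Lemma pow_bound_mono (M : E -> E) s t : pow_bound M s -> s <= t -> pow_bound M t.
Proof.
  intros [Hs [C [HC H]]] Hst. split; [lra|]. exists C. split; [easy|]. intros n x.
  apply Rle_trans with (1 := H n x).
  apply Rmult_le_compat_r; [apply bl_norm_ge0|].
  apply Rmult_le_compat_l; [easy|]. apply pow_incr. lra.
Qed.

(** One good power controls all of them. Divide the exponent by [S m]: the full blocks contribute
    [(s ^ S m) ^ q], and the remainder [r] costs at most the factor [D ^ S m] over [s ^ r], where
    [D >= 1] absorbs [C / s]. *)
Lemma pow_bound_root (M : E -> E) C m s : 0 < C -> bounded_by M C -> 0 < s ->
  bounded_by (Nat.iter (S m) M) (s ^ S m) -> pow_bound M s.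
Proof.
  intros HC HM Hs Hm. split; [easy|].
  set (D := Rmax 1 (C / s)).
  assert (HD : 1 <= D) by apply Rmax_l.
  assert (HCs : C <= D * s).
  { replace C with (C / s * s) by (field; lra).
    apply Rmult_le_compat_r; [lra|apply Rmax_r]. }
  exists (D ^ S m). split; [apply pow_le; lra|]. intros n x.
  rewrite (Nat.div_mod n (S m)) by lia.
  set (q := (n / S m)%nat). pose proof (Nat.mod_upper_bound n (S m) ltac:(lia)) as Hr.
  set (r := (n mod S m)%nat) in *.
  rewrite Nat.iter_add.
  assert (Hq : forall y, Nat.iter (S m * q) M y = Nat.iter q (Nat.iter (S m) M) y).
  { intro y. induction q as [|q IH]; [now rewrite Nat.mul_0_r|].
    rewrite Nat.mul_succ_r, Nat.add_comm, Nat.iter_add, IH. easy. }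
  rewrite Hq. apply Rle_trans with ((s ^ S m) ^ q * norm (Nat.iter r M x)).
  { apply iter_norm; [apply pow_le; lra|easy]. }
  rewrite <- pow_mult, pow_add.
  assert (Hrn : norm (Nat.iter r M x) <= D ^ S m * s ^ r * norm x).
  { apply Rle_trans with (C ^ r * norm x); [apply iter_norm; [lra|easy]|].
    apply Rmult_le_compat_r; [apply bl_norm_ge0|].
    apply Rle_trans with ((D * s) ^ r); [apply pow_incr; lra|].
    rewrite Rpow_mult_distr. apply Rmult_le_compat_r; [apply pow_le; lra|].
    apply Rle_pow; [easy|lia]. }
  apply (Rmult_le_compat_l (s ^ (S m * q))) in Hrn; [|apply pow_le; lra]. lra.
Qed.

(** * Summation of the series with terms [c n *: M^n x] *)

Fixpoint psum (M : E -> E) (c : nat -> R) x n : E :=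
  match n with
  | O => 0%V
  | S n => (psum M c x n + c n *: Nat.iter n M x)%V
  end.

Definition sums (M : E -> E) (c : nat -> R) x l : Prop := converges (psum M c x) l.

(** The majorant is proportional to [norm x], so the sums form a bounded operator, with bound
    [K / (1 - q)]. *)
Definition dominated (M : E -> E) (c : nat -> R) (K q : R) : Prop :=
  0 <= K /\ 0 <= q < 1 /\ forall n x, norm (c n *: Nat.iter n M x) <= K * norm x * q ^ n.

Section Sums.
Variable M : E -> E.
Hypothesis HM : linear_op M.

Lemma sums_exists c K q x : dominated M c K q -> exists l, sums M c x l.
Proof.
  intros [HK [Hq H]]. apply geometric_converges with (K * norm x) q; trivial.
  - apply Rmult_le_pos; [easy|apply bl_norm_ge0].
  - intro n. simpl.
    replace (psum M c x n + c n *: Nat.iter n M x - psum M c x n)%V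
      with (c n *: Nat.iter n M x)%V by vec. apply H.
Qed.

Lemma sums_norm c K q x l : dominated M c K q -> sums M c x l ->
  norm l <= K / (1 - q) * norm x.
Proof.
  intros [HK [Hq H]] Hl. apply (converges_norm_le _ _ _ Hl). intro n.
  enough (norm (psum M c x n) <= K / (1 - q) * norm x * (1 - q ^ n)) as Hn.
  { apply Rle_trans with (1 := Hn). pose proof (pow_le q n (proj1 Hq)).
    assert (0 <= K / (1 - q) * norm x).
    { apply Rmult_le_pos; [|apply bl_norm_ge0].
      apply Rmult_le_pos; [lra|]. left. apply Rinv_0_lt_compat. lra. }
    nra. }
  induction n as [|n IH]; simpl.
  - rewrite norm0. lra.
  - apply Rle_trans with (1 := bl_normD _ _ _). specialize (H n x).
    replace (K / (1 - q) * norm x * (1 - q * q ^ n))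
      with (K / (1 - q) * norm x * (1 - q ^ n) + K * norm x * q ^ n) by (field; lra).
    lra.
Qed.

Lemma sums_unique c x l l' : sums M c x l -> sums M c x l' -> l = l'.
Proof. apply converges_unique. Qed.

Lemma sums_ext c d x l : (forall n, c n = d n) -> sums M c x l -> sums M d x l.
Proof.
  intro e. apply converges_ext. intro n. induction n as [|n IH]; simpl; [easy|].
  now rewrite IH, e.
Qed.

Lemma sums_lin_coef a b c d x l l' : sums M c x l -> sums M d x l' ->
  sums M (fun n => a * c n + b * d n) x (a *: l + b *: l')%V.
Proof.
  intros Hl Hl'. apply (converges_scal a) in Hl. apply (converges_scal b) in Hl'.
  apply converges_ext with (2 := converges_add _ _ _ _ Hl Hl').
  intro n. induction n as [|n IH]; simpl; [vec|]. rewrite <- IH. vec.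
Qed.

Lemma sums_lin_arg a b c x y l l' : sums M c x l -> sums M c y l' ->
  sums M c (a *: x + b *: y)%V (a *: l + b *: l')%V.
Proof.
  intros Hl Hl'. apply (converges_scal a) in Hl. apply (converges_scal b) in Hl'.
  apply converges_ext with (2 := converges_add _ _ _ _ Hl Hl').
  intro n. destruct (iter_linear M n HM) as [Hadd Hscal].
  induction n as [|n IH]; simpl; [vec|].
  destruct (iter_linear M n HM) as [Hadd' Hscal'].
  rewrite <- IH by easy. rewrite Hadd', !Hscal'. vec.
Qed.

(** Here the factor [M] split off from the later terms acts on the argument, which leads to
    [lam *: T x = x + T (M x)]. In [sums_head_image] it acts on the sum, by continuity of [M], which
    leads to [lam *: T x = x + M (T x)]. *)
Lemma sums_head c x l :
  sums M (fun n => c (S n)) (M x) l -> sums M c x (c O *: x + l)%V.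
Proof.
  intro H. apply converges_shift.
  apply converges_ext with (2 := converges_add _ _ _ _ (converges_const (c O *: x)%V) H).
  intro n. induction n as [|n IH].
  - simpl. vec.
  - cbn [psum]. rewrite <- Nat.iter_succ_r. cbn [psum] in IH. rewrite <- IH. vec.
Qed.

Lemma sums_head_image C c x l : bounded_by M C ->
  sums M (fun n => c (S n)) x l -> sums M c x (c O *: x + M l)%V.
Proof.
  intros HC H. apply sums_head.
  assert (HL : forall y z, norm (M y - M z) <= C * norm (y - z)).
  { intros y z. rewrite <- linear_sub by easy. apply HC. }
  apply converges_ext with (2 := converges_lipschitz M C _ _ HL H).
  intro n. induction n as [|n IH]; simpl; [now apply linear_zero|].
  rewrite (proj1 HM), (proj2 HM), IH, <- Nat.iter_succ_r. easy.
Qed.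

Lemma sums_ge0 c x l : positive_op M -> (forall n, 0 <= c n) -> (0 <= x)%V ->
  sums M c x l -> (0 <= l)%V.
Proof.
  intros Hp Hc Hx Hl. apply (converges_ge0 _ _ Hl). intro n.
  induction n as [|n IH]; simpl; [apply bl_le_refl|].
  apply add_ge0; [easy|]. apply bl_le_scal; [easy|]. now apply iter_positive.
Qed.

Lemma dominated_pow c m t : pow_bound M t -> t < m ->
  (forall n, Rabs (c n) <= (/ m) ^ S n) -> exists K q, dominated M c K q.
Proof.
  intros [Ht [C [HC H]]] Hm Hc. exists (C / m), (t / m).
  assert (Hi : 0 < / m) by (apply Rinv_0_lt_compat; lra).
  split; [apply Rmult_le_pos; lra|]. split.
  - split; [apply Rmult_le_pos; lra|].
    apply Rmult_lt_reg_r with m; [lra|]. replace (t / m * m) with t by (field; lra). lra.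
  - intros n x. rewrite bl_normZ.
    replace (C / m * norm x * (t / m) ^ n) with ((/ m) ^ S n * (C * t ^ n * norm x)).
    + apply Rmult_le_compat; [apply Rabs_pos|apply bl_norm_ge0|apply Hc|apply H].
    + unfold Rdiv. rewrite Rpow_mult_distr. simpl. ring.
Qed.

Lemma sums_op c K q : dominated M c K q -> exists T : E -> E, forall x, sums M c x (T x).
Proof.
  intro H. destruct (@boolp.choice E E (sums M c)) as [T HT].
  - intro x. now apply sums_exists with K q.
  - now exists T.
Qed.

Lemma sums_op_linear c (T : E -> E) : (forall x, sums M c x (T x)) -> linear_op T.
Proof.
  intro HT. split; intros.
  - apply (sums_unique c (x + y)%V); [apply HT|].
    pose proof (sums_lin_arg 1 1 c x y _ _ (HT x) (HT y)) as H.
    now rewrite !bl_scal1 in H.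
  - apply (sums_unique c (a *: x)%V); [apply HT|].
    pose proof (sums_lin_arg a 0 c x x _ _ (HT x) (HT x)) as H.
    replace (a *: x + 0 *: x)%V with (a *: x)%V in H by vec.
    now replace (a *: T x + 0 *: T x)%V with (a *: T x)%V in H by vec.
Qed.

End Sums.

End Operators.

(** * Resolvents *)

Section Resolvents.
Context {E : BanachLattice}.
Implicit Types x y z u l : E.

(** The two identities make [T] a two-sided inverse of [lam - M]. *)
Definition is_resolvent (M : E -> E) (lam : R) (T : E -> E) : Prop :=
  linear_op T /\ positive_op T /\ (exists K, bounded_by T K) /\
  (forall x, (lam *: T x = x + M (T x))%V) /\
  (forall x, (lam *: T x = x + T (M x))%V).

Lemma resolvent_exists (M : E -> E) C t lam : linear_op M -> positive_op M ->
  bounded_by M C -> pow_bound M t -> t < lam -> exists T, is_resolvent M lam T.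
Proof.
  intros HM Hp HC Ht Hlam. pose proof (proj1 Ht) as Ht0.
  assert (Hi : 0 < / lam) by (apply Rinv_0_lt_compat; lra).
  set (c := fun n => (/ lam) ^ S n).
  destruct (dominated_pow M c lam t Ht Hlam) as [K [q Hd]].
  { intro n. unfold c. rewrite Rabs_pos_eq; [lra|]. apply pow_le. lra. }
  destruct (sums_op M c K q Hd) as [T HT]. exists T.
  (* Multiplication by [lam] shifts the coefficients by one and puts 1 at the head. The padding
     [0 * c n] only fits the two-term form of [sums_lin_coef]. *)
  assert (Hlc : forall x, sums M (fun n => lam * c n + 0 * c n) x (lam *: T x)%V).
  { intro x. pose proof (sums_lin_coef M lam 0 c c x _ _ (HT x) (HT x)) as H.
    now replace (lam *: T x + 0 *: T x)%V with (lam *: T x)%V in H by vec. }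
  assert (Hshift : forall n, c n = lam * c (S n) + 0 * c (S n)).
  { intro n. unfold c. simpl. field. lra. }
  assert (Hhead : lam * c O + 0 * c O = 1) by (unfold c; simpl; field; lra).
  split; [now apply sums_op_linear with M c|]. split; [|split; [|split]].
  - intros x Hx. apply (sums_ge0 M c x); trivial.
    intro n. apply pow_le. lra.
  - exists (K / (1 - q)). intro x. now apply (sums_norm M c K q).
  - intro x. apply (sums_unique M _ x _ _ (Hlc x)).
    rewrite <- (bl_scal1 E x) at 2. rewrite <- Hhead.
    apply (sums_head_image M HM C (fun n => lam * c n + 0 * c n)); [easy|].
    apply sums_ext with (1 := Hshift). apply HT.
  - intro x. apply (sums_unique M _ x _ _ (Hlc x)).
    rewrite <- (bl_scal1 E x) at 2. rewrite <- Hhead.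
    apply (sums_head M (fun n => lam * c n + 0 * c n)).
    apply sums_ext with (1 := Hshift). apply HT.
Qed.

(* [c n + i d n = (a + i b)^-(n+1)], where [m2 = a^2 + b^2]. *)
Fixpoint inv_pow (a b m2 : R) (n : nat) : R * R :=
  match n with
  | O => (a / m2, - b / m2)
  | S n => let (c, d) := inv_pow a b m2 n in ((a * c + b * d) / m2, (a * d - b * c) / m2)
  end.

Lemma inv_pow_spec a b : 0 < a * a + b * b ->
  exists c d : nat -> R,
    a * c O - b * d O = 1 /\ b * c O + a * d O = 0 /\
    (forall n, a * c (S n) - b * d (S n) = c n /\ b * c (S n) + a * d (S n) = d n) /\
    forall n, Rabs (c n) <= (/ sqrt (a * a + b * b)) ^ S n /\
              Rabs (d n) <= (/ sqrt (a * a + b * b)) ^ S n.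
Proof.
  set (m2 := a * a + b * b). intro Hm.
  exists (fun n => fst (inv_pow a b m2 n)), (fun n => snd (inv_pow a b m2 n)).
  split; [|split; [|split]].
  - simpl. unfold m2. field. unfold m2 in Hm. lra.
  - simpl. field. lra.
  - intro n. simpl. destruct (inv_pow a b m2 n) as [c d]. simpl.
    unfold m2 in *. split; field; lra.
  - intro n. set (s := / sqrt m2).
    assert (Hs : 0 < s) by now apply Rinv_0_lt_compat, sqrt_lt_R0.
    assert (Hs2 : s * s = / m2).
    { unfold s. rewrite <- Rinv_mult, sqrt_sqrt; lra. }
    enough (fst (inv_pow a b m2 n) * fst (inv_pow a b m2 n) +
            snd (inv_pow a b m2 n) * snd (inv_pow a b m2 n) = s ^ S n * s ^ S n) as Hn.
    { assert (Hp : 0 <= s ^ S n) by (apply pow_le; lra).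
      pose proof (Rle_0_sqr (fst (inv_pow a b m2 n))).
      pose proof (Rle_0_sqr (snd (inv_pow a b m2 n))).
      split; rewrite <- (Rabs_pos_eq (s ^ S n)) by easy; apply Rsqr_le_abs_0;
        unfold Rsqr in *; lra. }
    induction n as [|n IH].
    + simpl. rewrite !Rmult_1_r, Hs2. unfold m2. field. unfold m2 in Hm. lra.
    + simpl inv_pow. destruct (inv_pow a b m2 n) as [c d]. cbn [fst snd] in *.
      replace (s ^ S (S n) * s ^ S (S n)) with ((s * s) * (s ^ S n * s ^ S n))
        by (simpl; ring).
      rewrite <- IH, Hs2. unfold m2. field. unfold m2 in Hm. lra.
Qed.

(** The complex Neumann series is summed as [T + i U] with real operators [T] and [U], which act on
    pairs like multiplication by a complex number. [ER] and [EI] are the real and imaginary parts of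
    one resolvent identity, [ER'] and [EI'] those of the other. *)
Lemma pow_bound_resolvent (M : E -> E) C t a b : linear_op M -> bounded_by M C ->
  pow_bound M t -> t < sqrt (a * a + b * b) -> in_resolvent M a b.
Proof.
  intros HM HC Ht Hab. pose proof (proj1 Ht) as Ht0.
  assert (Hm : 0 < a * a + b * b).
  { apply Rnot_le_lt. intro H. rewrite sqrt_neg_0 in Hab by easy. lra. }
  destruct (inv_pow_spec a b Hm) as [c [d [H0 [H0' [Hrec Hbd]]]]].
  destruct (dominated_pow M c _ t Ht Hab) as [K [q Hc]]; [apply Hbd|].
  destruct (dominated_pow M d _ t Ht Hab) as [K' [q' Hd]]; [apply Hbd|].
  destruct (sums_op M c K q Hc) as [T HT]. destruct (sums_op M d K' q' Hd) as [U HU].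
  pose proof (sums_op_linear M HM c T HT) as LT.
  pose proof (sums_op_linear M HM d U HU) as LU.
  assert (Hre : forall x, sums M (fun n => a * c n + (- b) * d n) x (a *: T x + (- b) *: U x)%V).
  { intro x. now apply sums_lin_coef. }
  assert (Him : forall x, sums M (fun n => b * c n + a * d n) x (b *: T x + a *: U x)%V).
  { intro x. now apply sums_lin_coef. }
  assert (ER : forall x, (a *: T x + (- b) *: U x = 1 *: x + T (M x))%V).
  { intro x. apply (sums_unique M _ x _ _ (Hre x)).
    replace 1 with (a * c O + (- b) * d O) by lra.
    apply (sums_head M (fun n => a * c n + (- b) * d n)).
    apply sums_ext with (2 := HT (M x)). intro n. destruct (Hrec n). lra. }
  assert (EI : forall x, (b *: T x + a *: U x = 0 *: x + U (M x))%V).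
  { intro x. apply (sums_unique M _ x _ _ (Him x)).
    replace 0 with (b * c O + a * d O) by lra.
    apply (sums_head M (fun n => b * c n + a * d n)).
    apply sums_ext with (2 := HU (M x)). intro n. destruct (Hrec n). lra. }
  assert (ER' : forall x, (a *: T x + (- b) *: U x = 1 *: x + M (T x))%V).
  { intro x. apply (sums_unique M _ x _ _ (Hre x)).
    replace 1 with (a * c O + (- b) * d O) by lra.
    apply (sums_head_image M HM C (fun n => a * c n + (- b) * d n)); [easy|].
    apply sums_ext with (2 := HT x). intro n. destruct (Hrec n). lra. }
  assert (EI' : forall x, (b *: T x + a *: U x = 0 *: x + M (U x))%V).
  { intro x. apply (sums_unique M _ x _ _ (Him x)).
    replace 0 with (b * c O + a * d O) by lra.
    apply (sums_head_image M HM C (fun n => b * c n + a * d n)); [easy|].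
    apply sums_ext with (2 := HU x). intro n. destruct (Hrec n). lra. }
  exists (fun p => (T (fst p) - U (snd p), U (fst p) + T (snd p))%V).
  split; [|split].
  - intros [x y]. unfold shifted_op. cbn [fst snd].
    rewrite !(linear_sub T), !(linear_sub U) by easy.
    rewrite !(proj1 LT), !(proj1 LU), !(proj2 LT), !(proj2 LU).
    pose proof (ER x) as e1. pose proof (ER y) as e2.
    pose proof (EI x) as e3. pose proof (EI y) as e4.
    f_equal.
    + replace (a *: T x - b *: T y - T (M x) - (b *: U x + a *: U y - U (M y)))%V
        with ((a *: T x + (- b) *: U x) - T (M x) - ((b *: T y + a *: U y) - U (M y)))%V
        by vec.
      rewrite e1, e4. vec.
    + replace (a *: U x - b *: U y - U (M x) + (b *: T x + a *: T y - T (M y)))%V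
        with ((b *: T x + a *: U x) - U (M x) + ((a *: T y + (- b) *: U y) - T (M y)))%V
        by vec.
      rewrite e3, e2. vec.
  - intros [x y]. unfold shifted_op. cbn [fst snd].
    rewrite (linear_sub M) by easy. rewrite (proj1 HM).
    pose proof (ER' x) as e1. pose proof (ER' y) as e2.
    pose proof (EI' x) as e3. pose proof (EI' y) as e4.
    f_equal.
    + replace (a *: (T x - U y) - b *: (U x + T y) - (M (T x) - M (U y)))%V
        with ((a *: T x + (- b) *: U x) - M (T x) - ((b *: T y + a *: U y) - M (U y)))%V
        by vec.
      rewrite e1, e4. vec.
    + replace (b *: (T x - U y) + a *: (U x + T y) - (M (U x) + M (T y)))%V
        with ((b *: T x + a *: U x) - M (U x) + ((a *: T y + (- b) *: U y) - M (T y)))%V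
        by vec.
      rewrite e3, e2. vec.
  - exists (K / (1 - q) + K' / (1 - q')). intros [x y]. unfold cnorm. cbn [fst snd].
    pose proof (sums_norm M c K q x _ Hc (HT x)) as B1.
    pose proof (sums_norm M c K q y _ Hc (HT y)) as B2.
    pose proof (sums_norm M d K' q' x _ Hd (HU x)) as B3.
    pose proof (sums_norm M d K' q' y _ Hd (HU y)) as B4.
    pose proof (norm_sub_le (T x) (U y)). pose proof (bl_normD E (U x) (T y)). lra.
Qed.

(** Single terms of the series for [T] and for its square, which lie below the sum because all terms
    are positive. Induction through [T y = / lam *: (y + M (T y))] replaces a product of series:
    each step for the square adds one more term coming from [T x], whence the factor [INR (S n)]. *)
Lemma resolvent_square_ge (M T : E -> E) lam n x : linear_op M -> positive_op M ->
  0 < lam -> is_resolvent M lam T -> (0 <= x)%V ->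
  ((/ lam) ^ S n *: Nat.iter n M x <= T x)%V /\
  ((INR (S n) * (/ lam) ^ S (S n)) *: Nat.iter n M x <= T (T x))%V.
Proof.
  intros HM Hp Hlam [LT [PT [_ [HT _]]]] Hx.
  assert (Hi : 0 < / lam) by now apply Rinv_0_lt_compat.
  assert (eT : forall y, T y = (/ lam *: (y + M (T y)))%V).
  { intro y. rewrite <- HT, bl_scalA, Rinv_l, bl_scal1 by lra. easy. }
  assert (PTx : (0 <= T x)%V) by now apply PT.
  induction n as [|n [IH1 IH2]].
  - split.
    + rewrite (eT x) at 1. apply (le_of_comb1 (/ lam) _ _ 0 (M (T x))); [lra|now apply Hp|].
      cbn [Nat.iter nat_rect pow]. vec.
    + assert (H1 : (/ lam *: x <= T x)%V).
      { rewrite (eT x). apply (le_of_comb1 (/ lam) _ _ 0 (M (T x))); [lra|now apply Hp|].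
        vec. }
      rewrite (eT (T x)).
      apply (le_of_comb2 (/ lam) (/ lam) _ _ _ _ _ _ ltac:(lra) ltac:(lra)
               (Hp _ (PT _ PTx)) H1).
      cbn [Nat.iter nat_rect pow INR]. vec.
  - assert (S1 : ((/ lam) ^ S (S n) *: Nat.iter (S n) M x <= T x)%V).
    { pose proof (positive_le M _ _ HM Hp IH1) as H. rewrite (proj2 HM) in H.
      rewrite (eT x). apply (le_of_comb2 (/ lam) (/ lam) _ _ _ _ _ _ ltac:(lra) ltac:(lra) H Hx).
      rewrite Nat.iter_succ. cbn [pow]. vec. }
    split; [easy|].
    pose proof (positive_le M _ _ HM Hp IH2) as H. rewrite (proj2 HM) in H.
    rewrite (eT (T x)).
    apply (le_of_comb2 (/ lam) (/ lam) _ _ _ _ _ _ ltac:(lra) ltac:(lra) H S1).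
    rewrite (S_INR (S n)), Nat.iter_succ. cbn [pow]. vec.
Qed.

(* Since [T (T x) >= (n+1) lam^-(n+2) M^n x] for [x >= 0], a bound on the resolvents near
   [rho] would improve the growth rate of the powers of [M] below [rho]. *)
Lemma resolvent_unbounded (M : E -> E) C rho : linear_op M -> positive_op M ->
  0 < C -> bounded_by M C -> 0 < rho -> (forall t, pow_bound M t -> rho <= t) ->
  forall B, exists del, 0 < del /\ forall lam T K, rho < lam < rho + del ->
    is_resolvent M lam T -> bounded_by T K -> B < K.
Proof.
  intros HM Hp HC HMC Hrho Hmin B0. set (B := Rmax B0 1).
  assert (HB1 : 1 <= B) by apply Rmax_r.
  set (L := rho + 1).
  (* With [L] an upper bound for [lam], the factor [n + 1] outweighs [2 L^2 B^2], so that [M^n] is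
     bounded by [lam ^ n / 2]. The gained half is [th ^ n], and the rate drops to [lam * th]. *)
  destruct (INR_unbounded (2 * (L * L) * (B * B))) as [m Hm].
  set (n := S m).
  set (th := Rpower 2 (- / INR n)).
  assert (Hn0 : 0 < INR n) by (apply lt_0_INR; lia).
  assert (Hth : 0 < th) by apply exp_pos.
  assert (Hth1 : th < 1).
  { rewrite <- (Rpower_O 2) by lra. apply Rpower_lt; [lra|].
    assert (0 < / INR n) by now apply Rinv_0_lt_compat. lra. }
  assert (Hthn : th ^ n = / 2).
  { unfold th. rewrite <- Rpower_pow by easy. rewrite Rpower_mult.
    replace (- / INR n * INR n) with (Ropp 1) by (field; lra).
    rewrite Rpower_Ropp, Rpower_1; lra. }
  (* The first entry ensures [lam <= L], the second [lam * th < rho], which contradicts the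
     minimality of [rho]. *)
  exists (Rmin 1 (rho / th - rho)). split.
  { apply Rmin_pos; [lra|]. apply Rlt_0_minus.
    apply Rmult_lt_reg_r with th; [easy|]. replace (rho / th * th) with rho by (field; lra).
    rewrite <- (Rmult_1_r rho) at 2. apply Rmult_lt_compat_l; lra. }
  intros lam T K [Hl1 Hl2] HT HTK.
  pose proof (Rmin_l 1 (rho / th - rho)). pose proof (Rmin_r 1 (rho / th - rho)).
  apply Rnot_le_lt. intro HK.
  assert (HKB : bounded_by T B).
  { intro x. apply Rle_trans with (1 := HTK x).
    apply Rmult_le_compat_r; [apply bl_norm_ge0|].
    apply Rle_trans with (1 := HK). apply Rmax_l. }
  assert (Hlth : lam * th < rho).
  { apply Rlt_le_trans with (rho / th * th).
    - apply Rmult_lt_compat_r; lra.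
    - right. field. lra. }
  apply (Rlt_not_le _ _ Hlth). apply Hmin.
  apply (pow_bound_root M C m (lam * th) HC HMC); [apply Rmult_lt_0_compat; lra|].
  fold n. intro x.
  apply Rle_trans with (1 := positive_norm_abs _ x (iter_linear M n HM) (iter_positive M n Hp)).
  rewrite <- (norm_abs x). set (y := abs x). assert (Hy : (0 <= y)%V) by apply abs_ge0.
  destruct (resolvent_square_ge M T lam n y HM Hp ltac:(lra) HT Hy) as [_ H2].
  apply norm_le_pos in H2.
  2: { apply bl_le_scal; [|now apply iter_positive].
       apply Rmult_le_pos; [apply pos_INR|]. apply pow_le. left. apply Rinv_0_lt_compat. lra. }
  assert (HTT : norm (T (T y)) <= B * (B * norm y)).
  { apply Rle_trans with (1 := HKB _). apply Rmult_le_compat_l; [lra|]. apply HKB. }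
  rewrite bl_normZ, Rabs_pos_eq in H2.
  2: { apply Rmult_le_pos; [apply pos_INR|]. apply pow_le. left. apply Rinv_0_lt_compat. lra. }
  rewrite Rpow_mult_distr, Hthn.
  assert (Hln : 0 < lam ^ n) by (apply pow_lt; lra).
  assert (e : (/ lam) ^ S (S n) = / (lam ^ n * (lam * lam))).
  { rewrite pow_inv. f_equal. simpl. ring. }
  rewrite e in H2.
  assert (HN : INR n <= INR (S n)) by (apply le_INR; lia).
  assert (Hmn : INR m <= INR n) by (apply le_INR; lia).
  assert (Hll : lam * lam <= L * L) by (apply Rmult_le_compat; unfold L; lra).
  set (w := norm (Nat.iter n M y)) in *. set (v := norm y) in *.
  assert (Hv : 0 <= v) by apply bl_norm_ge0.
  assert (H3 : INR (S n) * w <= (B * B) * v * (lam ^ n * (lam * lam))).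
  { apply Rmult_le_reg_r with (/ (lam ^ n * (lam * lam))).
    - apply Rinv_0_lt_compat. apply Rmult_lt_0_compat; [easy|]. nra.
    - replace (B * B * v * (lam ^ n * (lam * lam)) * / (lam ^ n * (lam * lam)))
        with (B * B * v) by (field; split; lra).
      lra. }
  assert (H4 : (B * B) * v * (lam ^ n * (lam * lam)) <= (B * B) * v * (lam ^ n * (L * L))).
  { apply Rmult_le_compat_l; [apply Rmult_le_pos; nra|]. apply Rmult_le_compat_l; lra. }
  assert (H5 : 2 * ((B * B) * v * (lam ^ n * (L * L))) <= INR (S n) * (lam ^ n * v)).
  { replace (2 * ((B * B) * v * (lam ^ n * (L * L))))
      with ((2 * (L * L) * (B * B)) * (lam ^ n * v)) by ring.
    apply Rmult_le_compat_r; [apply Rmult_le_pos; lra|lra]. }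
  apply Rmult_le_reg_l with (INR (S n)); lra.
Qed.

(** The least bound is needed for its nearly norming vectors, on which the compactness argument
    operates. *)
Lemma operator_norm (T : E -> E) K : linear_op T -> bounded_by T K -> 0 < K ->
  exists N, 0 <= N /\ bounded_by T N /\
    forall r, 0 <= r < N -> exists v, norm v <= 1 /\ r < norm (T v).
Proof.
  intros HT HK HK0.
  destruct (completeness (fun r => exists v, norm v <= 1 /\ r = norm (T v))) as [N [HN1 HN2]].
  - exists K. intros r [v [Hv ->]]. apply Rle_trans with (1 := HK v).
    rewrite <- (Rmult_1_r K) at 2. apply Rmult_le_compat_l; lra.
  - exists (norm (T 0%V)), 0%V. split; [rewrite norm0; lra|easy].
  - assert (HN : 0 <= N).
    { apply Rle_trans with (norm (T 0%V)); [apply bl_norm_ge0|].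
      apply HN1. exists 0%V. split; [rewrite norm0; lra|easy]. }
    exists N. split; [easy|]. split.
    + intro x. destruct (Req_dec (norm x) 0) as [e|ne].
      { rewrite (bl_norm_eq0 E x e), linear_zero, !norm0 by easy. lra. }
      pose proof (bl_norm_ge0 E x).
      assert (Hi : 0 < / norm x) by (apply Rinv_0_lt_compat; lra).
      assert (H1 : norm (T (/ norm x *: x)%V) <= N).
      { apply HN1. exists (/ norm x *: x)%V. split; [|easy].
        rewrite bl_normZ, Rabs_pos_eq, Rinv_l by lra. lra. }
      rewrite (proj2 HT), bl_normZ, Rabs_pos_eq in H1 by lra.
      apply (Rmult_le_compat_r (norm x)) in H1; [|easy].
      now replace (/ norm x * norm (T x) * norm x) with (norm (T x)) in H1 by (field; easy).
    + intros r Hr. apply NNPP. intro Hno. apply (Rlt_not_le N r); [easy|].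
      apply HN2. intros s [v [Hv ->]]. apply Rnot_lt_le. intro Hlt. apply Hno. now exists v.
Qed.

End Resolvents.

(** * A positive eigenfunctional *)

Section Eigenfunctional.
Context {E : BanachLattice}.
Variables (M : E -> E) (C rho : R).
Hypotheses (HM : linear_op M) (Hp : positive_op M) (Hc : compact_op M).
Hypotheses (HC : 0 < C) (HMC : bounded_by M C).
Hypothesis Hrho : 0 < rho.
Hypothesis Habove : forall t, rho < t -> pow_bound M t.
Hypothesis Hbelow : forall t, pow_bound M t -> rho <= t.

Lemma blowing_up_resolvents (k : nat) :
  exists lam T N v, rho < lam /\ (lam - rho) * (INR k + 1) <= 1 /\ is_resolvent M lam T /\
    INR k + 1 < N /\ bounded_by T N /\ norm (v : E) <= 1 /\ N / 2 < norm (T v).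
Proof.
  pose proof (pos_INR k).
  destruct (resolvent_unbounded M C rho HM Hp HC HMC Hrho Hbelow (INR k + 1))
    as [del [Hdel Hdel']].
  assert (Hk : 0 < / (INR k + 1)) by (apply Rinv_0_lt_compat; lra).
  set (lam := rho + Rmin del (/ (INR k + 1)) / 2).
  pose proof (Rmin_l del (/ (INR k + 1))). pose proof (Rmin_r del (/ (INR k + 1))).
  pose proof (Rmin_pos _ _ Hdel Hk).
  (* The midpoint is an admissible rate, being above [rho], and still lies strictly below [lam]. *)
  destruct (resolvent_exists M C ((rho + lam) / 2) lam HM Hp HMC) as [T HT].
  { apply Habove. unfold lam. lra. }
  { unfold lam. lra. }
  pose proof HT as [LT [_ [[K HK] _]]].
  destruct (operator_norm T (Rmax K 1)) as [N [HN [HTN Hv]]]; trivial.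
  { intro x. apply Rle_trans with (1 := HK x).
    apply Rmult_le_compat_r; [apply bl_norm_ge0|apply Rmax_l]. }
  { pose proof (Rmax_r K 1). lra. }
  assert (HkN : INR k + 1 < N) by (apply (Hdel' lam T); trivial; unfold lam; lra).
  destruct (Hv (N / 2) ltac:(lra)) as [v [Hv1 Hv2]].
  exists lam, T, N, v. split; [unfold lam; lra|]. split; [|easy].
  apply Rle_trans with (/ (INR k + 1) * (INR k + 1)).
  - apply Rmult_le_compat_r; [lra|]. unfold lam. lra.
  - rewrite Rinv_l; lra.
Qed.

(* [v k] almost attains the norm of the resolvent [T k]; so does the image [M (v k)], up to a
   factor, and by compactness one may replace [M (v k)] by a fixed vector [z], then by [abs z].
   On the other hand [u + rho y - M y <= e] bounds [T k u] by [T k e] up to lower order terms. *)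
Lemma separated_vector : exists (u : E) (del : R), 0 < del /\
  forall y e, (u + rho *: y - M y <= e)%V -> del <= norm e.
Proof.
  destruct (boolp.choice blowing_up_resolvents) as [lam H1].
  destruct (boolp.choice H1) as [T H2]. destruct (boolp.choice H2) as [N H3].
  destruct (boolp.choice H3) as [v H]. clear H1 H2 H3.
  destruct (Hc v) as [phi [Hphi [z Hz]]]; [exists 1; apply H|].
  assert (Hge : forall n, (n <= phi n)%nat).
  { induction n as [|n IH]; [lia|]. specialize (Hphi n). lia. }
  (* The main term is [rho * n / 2]. Four errors of at most [rho * n / 16] are set against it:
     replacing [M w] by [z], the term [t e], the term [(l - rho) *: t y], and [norm y + 1]. They
     total only [rho * n / 4]. *)
  exists (abs z), (rho / 16). split; [lra|]. intros y e He. apply Rnot_lt_le. intro Hlt.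
  destruct (Hz (rho / 16) ltac:(lra)) as [m Hm].
  pose proof (bl_norm_ge0 E y) as Hy0.
  (* [y] is fixed before the index, so [j] may be taken so large that [norm y + 1] is small against
     [n] and [(l - rho) * norm y] is small outright. *)
  destruct (INR_unbounded ((norm y + 1) * 16 / rho)) as [k Hk].
  set (j := phi (max m k)). specialize (Hm (max m k) ltac:(lia)). fold j in Hm.
  assert (Hkj : INR k <= INR j).
  { apply le_INR. pose proof (Hge (max m k)). unfold j. lia. }
  destruct (H j) as [Hl1 [Hl2 [HT [HkN [HTN [Hv1 Hv2]]]]]].
  destruct HT as [LT [PT [_ [_ HTM]]]].
  set (t := T j) in *. set (n := N j) in *. set (l := lam j) in *. set (w := v j) in *.
  assert (HJ : norm y + 1 <= rho / 16 * (INR j + 1)).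
  { replace (norm y + 1) with (rho / 16 * ((norm y + 1) * 16 / rho)) by (field; lra).
    apply Rmult_le_compat_l; lra. }
  assert (HNy : norm y + 1 <= rho / 16 * n).
  { apply Rle_trans with (1 := HJ). apply Rmult_le_compat_l; lra. }
  assert (Hly : (l - rho) * norm y <= rho / 16).
  { apply Rle_trans with ((l - rho) * (rho / 16 * (INR j + 1))).
    - apply Rmult_le_compat_l; lra.
    - replace ((l - rho) * (rho / 16 * (INR j + 1)))
        with (rho / 16 * ((l - rho) * (INR j + 1))) by ring.
      rewrite <- (Rmult_1_r (rho / 16)) at 2. apply Rmult_le_compat_l; lra. }
  assert (Hn0 : 0 < n) by (pose proof (pos_INR j); lra).
  assert (B1 : rho * n / 2 - 1 <= norm (t (M w))).
  { replace (t (M w)) with (l *: t w - w)%V by (rewrite HTM; vec).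
    apply Rle_trans with (2 := norm_sub_ge _ _).
    rewrite bl_normZ, Rabs_pos_eq by lra.
    assert (rho * (n / 2) <= l * norm (t w)) by (apply Rmult_le_compat; lra). lra. }
  assert (B2 : norm (t (M w)) - n * (rho / 16) <= norm (t z)).
  { assert (norm (t (M w) - t z) <= n * (rho / 16)).
    { rewrite <- linear_sub by easy. apply Rle_trans with (1 := HTN _).
      apply Rmult_le_compat_l; lra. }
    pose proof (norm_sub_ge (t (M w)) (t z)). lra. }
  (* Apply the positive operator [t] to the inequality [He] and substitute [t (M y) = l *: t y - y]:
     the two large multiples of [t y] combine to the small coefficient [l - rho]. *)
  assert (B3 : norm (t z) <= norm (t e - y + (l - rho) *: t y)).
  { apply Rle_trans with (1 := positive_norm_abs t z LT PT).
    apply norm_le_pos; [apply PT, abs_ge0|].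
    apply (positive_le t _ _ LT PT) in He.
    rewrite linear_sub, (proj1 LT), (proj2 LT) in He by easy.
    apply (le_of_comb1 1 _ _ _ _ ltac:(lra) He).
    replace (t (M y)) with (l *: t y - y)%V by (rewrite HTM; vec). vec. }
  assert (B4 : norm (t e - y + (l - rho) *: t y) <= n * (rho / 16) + norm y + n * (rho / 16)).
  { apply Rle_trans with (1 := bl_normD _ _ _).
    pose proof (norm_sub_le (t e) y).
    assert (norm (t e) <= n * (rho / 16)).
    { apply Rle_trans with (1 := HTN e). apply Rmult_le_compat_l; lra. }
    assert (norm ((l - rho) *: t y) <= n * (rho / 16)).
    { rewrite bl_normZ, Rabs_pos_eq by lra.
      apply Rle_trans with ((l - rho) * (n * norm y)).
      - apply Rmult_le_compat_l; [lra|apply HTN].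
      - replace ((l - rho) * (n * norm y)) with (n * ((l - rho) * norm y)) by ring.
        apply Rmult_le_compat_l; lra. }
    lra. }
  assert (0 < n * rho) by (apply Rmult_lt_0_compat; lra). lra.
Qed.

(** [p x] is the distance from [x] to the wedge [(rho - M) E - E_+]. A linear [f <= p] is
    nonpositive on the wedge, hence nonnegative on [E_+] and zero on the subspace [(rho - M) E];
    attaining [p u] at [u] makes it nonzero. *)
Lemma eigenfunctional : exists f : E -> R, dual_positive f /\ (exists x, f x <> 0) /\
  (forall x, f x <= norm x) /\ forall x, f (M x) = rho * f x.
Proof.
  destruct separated_vector as [u [del [Hdel Hu]]].
  set (P := fun x r => exists y e, (x + rho *: y - M y <= e)%V /\ r = norm e).
  assert (Hne : forall x, exists r, P x r).
  { intro x. exists (norm x), 0%V, x. split; [|easy].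
    rewrite (linear_zero M) by easy. replace (x + rho *: 0 - 0)%V with x by vec.
    apply bl_le_refl. }
  destruct (inf_fun P (fun _ => 0) Hne) as [p Hpinf].
  { intros x r [y [e [_ ->]]]. apply bl_norm_ge0. }
  assert (Hle : forall x y e, (x + rho *: y - M y <= e)%V -> p x <= norm e).
  { intros x y e H. apply (Hpinf x). now exists y, e. }
  assert (Hs : sublinear p).
  { split.
    - intros x x'. apply (inf_add _ _ _ _ _ (Hpinf x) (Hpinf x')).
      intros r s [y [e [He ->]]] [y' [e' [He' ->]]].
      apply Rle_trans with (2 := bl_normD E e e'). apply (Hle _ (y + y')%V).
      apply (le_of_comb2 1 1 _ _ _ _ _ _ ltac:(lra) ltac:(lra) He He').
      rewrite (proj1 HM). vec.
    - intros t x Ht. apply (inf_scal _ _ _ _ (Hpinf x) (Hne x) Ht).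
      intros r [y [e [He ->]]]. rewrite <- (Rabs_pos_eq t) at 2 by easy.
      rewrite <- bl_normZ. apply (Hle _ (t *: y)%V).
      apply (le_of_comb1 t _ _ _ _ Ht He). rewrite (proj2 HM). vec. }
  destruct (hahn_banach p u Hs) as [f [Hadd [Hscal [Hfp Hfu]]]].
  assert (Hpn : forall x, p x <= norm x).
  { intro x. apply (Hle x 0%V). rewrite (linear_zero M) by easy.
    replace (x + rho *: 0 - 0)%V with x by vec. apply bl_le_refl. }
  assert (Hopp : forall x, f (- x)%V = - f x).
  { intro x. rewrite oppE, Hscal. ring. }
  assert (Hfn : forall x, f x <= norm x).
  { intro x. apply Rle_trans with (p x); trivial. }
  assert (Hker : forall y, f (M y - rho *: y)%V <= 0).
  { intro y. apply Rle_trans with (1 := Hfp _). rewrite <- (norm0 (E := E)).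
    apply (Hle _ y). replace (M y - rho *: y + rho *: y - M y)%V with (0 : E)%V by vec.
    apply bl_le_refl. }
  exists f. repeat split; trivial.
  - exists 1. intro x. rewrite Rmult_1_l. apply Rabs_le. split; [|easy].
    specialize (Hfn (- x)%V). rewrite Hopp, normN in Hfn. lra.
  - intros x Hx. enough (f (- x)%V <= 0) by (rewrite Hopp in *; lra).
    apply Rle_trans with (1 := Hfp _). rewrite <- (norm0 (E := E)).
    apply (Hle _ 0%V). rewrite (linear_zero M) by easy.
    apply (le_of_comb1 1 _ _ _ _ ltac:(lra) Hx). vec.
  - exists u. assert (del <= p u); [|lra].
    apply (Hpinf u). intros r [y [e [He ->]]]. now apply Hu with y.
  - intro x. pose proof (Hker x) as H1. pose proof (Hker (- x)%V) as H2.
    rewrite linear_opp in H2 by easy.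
    replace (- M x - rho *: - x)%V with (- (M x - rho *: x))%V in H2 by vec.
    rewrite Hopp in H2.
    replace (M x - rho *: x)%V with (M x + (- rho) *: x)%V in H1, H2 by vec.
    rewrite Hadd, Hscal in H1, H2. lra.
Qed.

End Eigenfunctional.

(** * Roots *)

Lemma nth_root_pow s n : 0 < s -> Rpower (s ^ S n) (/ INR (S n)) = s.
Proof.
  intro Hs. rewrite <- Rpower_pow, Rpower_mult, Rinv_r, Rpower_1; trivial.
  apply not_0_INR. lia.
Qed.

Lemma nth_root_le x s n : 0 <= x <= s ^ S n -> 0 < s -> nth_root x (S n) <= s.
Proof.
  intros Hx Hs. unfold nth_root. destruct (Req_EM_T x 0); [lra|].
  rewrite <- (nth_root_pow s n Hs).
  apply Rle_Rpower_l; [|lra]. left. apply Rinv_0_lt_compat, lt_0_INR. lia.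
Qed.

Lemma nth_root_ge x s n : s ^ S n <= x -> 0 < s -> s <= nth_root x (S n).
Proof.
  intros Hx Hs. pose proof (pow_lt s (S n) Hs).
  unfold nth_root. destruct (Req_EM_T x 0); [lra|].
  rewrite <- (nth_root_pow s n Hs) at 1.
  apply Rle_Rpower_l; [|lra]. left. apply Rinv_0_lt_compat, lt_0_INR. lia.
Qed.

Lemma nth_root_ge0 x n : 0 <= nth_root x n.
Proof. unfold nth_root. destruct (Req_EM_T x 0); [lra|]. left. apply exp_pos. Qed.

(** A constant factor disappears under n-th roots: any strictly larger rate absorbs it. *)
Lemma pow_dominates C s t : 0 <= s < t -> 0 <= C ->
  exists N, forall n, (N <= n)%nat -> C * s ^ n <= t ^ n.
Proof.
  intros Hst HC.
  assert (Hq : 0 <= s / t < 1).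
  { split; [apply Rmult_le_pos; [lra|left; apply Rinv_0_lt_compat; lra]|].
    apply Rmult_lt_reg_r with t; [lra|]. replace (s / t * t) with s by (field; lra). lra. }
  destruct (pow_lt_1_zero (s / t) ltac:(rewrite Rabs_pos_eq; lra) (/ (C + 1)))
    as [N HN]; [apply Rinv_0_lt_compat; lra|].
  exists N. intros n Hn. specialize (HN n Hn).
  rewrite Rabs_pos_eq in HN by now apply pow_le.
  assert (Ht : 0 < t ^ n) by (apply pow_lt; lra).
  replace (s ^ n) with ((s / t) ^ n * t ^ n)
    by (rewrite <- Rpow_mult_distr; f_equal; field; lra).
  assert (C * (s / t) ^ n <= 1).
  { pose proof (pow_le (s / t) n (proj1 Hq)).
    apply (Rmult_lt_compat_l (C + 1)) in HN; [|lra]. rewrite Rinv_r in HN; lra. }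
  rewrite <- Rmult_assoc. rewrite <- (Rmult_1_l (t ^ n)) at 2.
  apply Rmult_le_compat_r; lra.
Qed.

(** [a n] belongs to the exponent [S n], so exponent 0 never occurs. [K] is absorbed between
    [r + eps / 4] and [r + eps / 2], and [c] between [r - eps / 2] and [r]. When [r - eps / 2 <= 0]
    the lower bound is mere nonnegativity of roots, which covers [r = 0]. *)
Lemma nth_root_cv (a : nat -> R) r c : 0 <= r -> 0 < c -> (forall n, 0 <= a n) ->
  (forall t, r < t -> exists K, 0 <= K /\ forall n, a n <= K * t ^ S n) ->
  (forall n, 0 < r -> c * r ^ S n <= a n) ->
  Un_cv (fun n => nth_root (a n) (S n)) r.
Proof.
  intros Hr Hc Ha Hup Hlow eps Heps.
  destruct (Hup (r + eps / 4) ltac:(lra)) as [K [HK HaK]].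
  destruct (pow_dominates K (r + eps / 4) (r + eps / 2) ltac:(lra) HK) as [N HN].
  assert (exists N', forall n, (N' <= n)%nat -> r - eps / 2 <= nth_root (a n) (S n))
    as [N' HN'].
  { destruct (Rle_dec (r - eps / 2) 0) as [Hs|Hs].
    - exists O. intros n _. pose proof (nth_root_ge0 (a n) (S n)). lra.
    - destruct (pow_dominates (/ c) (r - eps / 2) r ltac:(lra)) as [N' HN'].
      { left. now apply Rinv_0_lt_compat. }
      exists N'. intros n Hn. apply nth_root_ge; [|lra].
      apply Rle_trans with (2 := Hlow n ltac:(lra)).
      specialize (HN' (S n) ltac:(lia)). apply (Rmult_le_compat_l c) in HN'; [|lra].
      rewrite <- Rmult_assoc, Rinv_r, Rmult_1_l in HN' by lra. easy. }
  exists (max N N'). intros n Hn. specialize (HN (S n) ltac:(lia)).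
  specialize (HN' n ltac:(lia)). specialize (HaK n).
  assert (nth_root (a n) (S n) <= r + eps / 2).
  { apply nth_root_le; [|lra]. split; [easy|lra]. }
  unfold Rdist. apply Rabs_def1; lra.
Qed.

Theorem mainTheorem10 (E : BanachLattice) (M : E -> E) (h : E) :
  linear_op M -> positive_op M -> compact_op M -> quasi_interior h ->
  exists r, spectral_radius_is M r /\
    Un_cv (fun n => nth_root (bl_norm E (Nat.iter (S n) M h)) (S n)) r.
Proof.
  intros HM Hp Hc [Hh0 Hh].
  destruct (compact_bounded M HM Hc) as [C [HC HMC]].
  destruct (inf_exists (pow_bound M) 0) as [rho [Hlow Hgreat]].
  { exists C. now apply bounded_pow_bound. }
  { intros t [Ht _]. lra. }
  assert (Hrho : 0 <= rho) by (apply Hgreat; intros t [Ht _]; lra).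
  assert (Habove : forall t, rho < t -> pow_bound M t).
  { intros t Ht. apply NNPP. intro Hno. apply (Rlt_not_le _ _ Ht).
    apply Hgreat. intros s Hs. apply Rnot_lt_le. intro Hst.
    apply Hno. apply pow_bound_mono with s; trivial. lra. }
  assert (Heig : 0 < rho -> exists f : E -> R, dual_positive f /\ (exists x, f x <> 0) /\
            (forall x, f x <= norm x) /\ forall x, f (M x) = rho * f x).
  { intro H0. now apply (eigenfunctional M C rho). }
  exists rho. split.
  - split.
    + intros s [->|[a [b [Hs ->]]]]; [easy|]. apply Rnot_lt_le. intro Hlt.
      apply Hs. apply (pow_bound_resolvent M C ((rho + sqrt (a * a + b * b)) / 2)); trivial.
      * apply Habove. lra.
      * lra.
    (* For [rho = 0] the convention that 0 belongs to the set settles the claim; otherwise [rho]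
       itself is shown to lie in the spectrum. *)
    + intros b Hb. destruct (Req_dec rho 0) as [->|n]; [apply Hb; now left|].
      destruct (Heig ltac:(lra)) as [f [[Hadd [Hscal _]] [[u Hu] [_ HfM]]]].
      apply Hb. right. exists rho, 0. split.
      (* A right inverse would solve [rho *: x - M x = u] in the first component, since the
         imaginary part of the point is 0; applying [f] gives [f u = 0]. *)
      * intros [S [_ [HS _]]]. specialize (HS (u, 0%V)).
        destruct (S (u, 0%V)) as [x y]. unfold shifted_op in HS. injection HS as HS _.
        apply Hu. rewrite <- HS.
        replace (rho *: x - 0 *: y - M x)%V with (rho *: x + (-1) *: M x)%V by vec.
        rewrite Hadd, !Hscal, HfM. ring.
      * replace (rho * rho + 0 * 0) with (rho * rho) by ring. now rewrite sqrt_square.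
  - assert (exists c, 0 < c /\ forall n, 0 < rho -> c * rho ^ S n <= norm (Nat.iter (S n) M h))
      as [c [Hc0 Hcn]].
    { destruct (Req_dec rho 0) as [e|n]; [exists 1; split; intros; lra|].
      destruct (Heig ltac:(lra)) as [f [Hf [Hu [Hfn HfM]]]].
      (* [f] lies below the norm, so [f h] serves as the constant without further scaling. *)
      exists (f h). split; [now apply Hh|]. intros n' _.
      apply Rle_trans with (2 := Hfn _). right.
      generalize (S n'). intro k. induction k as [|k IH]; simpl; [ring|].
      rewrite HfM, <- IH. ring. }
    apply nth_root_cv with c; trivial.
    + intro n. apply bl_norm_ge0.
    + intros t Ht. destruct (Habove t Ht) as [_ [K [HK HKn]]].
      exists (K * norm h). split; [apply Rmult_le_pos; [easy|apply bl_norm_ge0]|].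
      intro n. specialize (HKn (S n) h). lra.
Qed.
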